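(* There exists a universal $\varepsilon_0>0$ such that the following holds. Suppose $y_0:\mathbb{R}\to[0,\infty)$ is a locally Lipschitz function with $A_0:=\|y_0\|_{L^1(\mathbb{R})}\in(0,\infty)$, and let $y:\mathbb{R}\times[0,\infty)\to\mathbb{R}$ be the unique Ecker-Huisken solution of $y_t=\frac{y_{xx}}{1+y_x^2}$ starting with $y_0$. Then for all $t>\tau:=\frac{A_0}{\pi}$ with $\frac{\pi}{2}-\frac{A_0}{2t}<\varepsilon_0$ we have $$y(x,t)\leq 2t^{1/2}\sqrt{-\log\left(\frac{\pi}{2}-\frac{A_0}{2t}\right)}$$ for all $x\in\mathbb{R}$.
   Context: Graphical curve shortening flow is the equation $y_t=\frac{y_{xx}}{1+y_x^2}=(\arctan y_x)_x$. For every locally Lipschitz $y_0:\mathbb{R}\to\mathbb{R}$ there is (Ecker-Huisken existence, Chou-Zhu uniqueness) a unique continuous function $y:\mathbb{R}\times[0,\infty)\to\mathbb{R}$ that is smooth and solves this equation on $\mathbb{R}\times(0,\infty)$, with $y(\cdot,0)=y_0$ and $y(\cdot,t)\to y_0$ locally uniformly as $t\downarrow 0$. It is called the Ecker-Huisken solution starting with $y_0$. *)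

(* Defs.v *)
From HB Require Import structures.
From mathcomp Require Import all_boot all_order all_algebra.
From mathcomp Require Import all_classical all_reals all_analysis.

Set Implicit Arguments.
Unset Strict Implicit.
Unset Printing Implicit Defensive.

Import Order.TTheory GRing.Theory Num.Theory.
Import numFieldNormedType.Exports.

Local Open Scope classical_set_scope.
Local Open Scope ring_scope.

(* Points of space-time are pairs (x, t). *)
Definition partial_x (R : realType) (f : R * R -> R) : R * R -> R :=
  fun p => 'D_(1 : R, 0 : R) f p.

Definition partial_t (R : realType) (f : R * R -> R) : R * R -> R :=
  fun p => 'D_(0 : R, 1 : R) f p.

(* Intended for open U, where the values of f outside U are irrelevant. *)
Fixpoint Ck_on (R : realType) (U : set (R * R)) (k : nat) (f : R * R -> R)
    : Prop :=
  if k is k'.+1 then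
    [/\ forall p, U p -> derivable f p (1 : R, 0 : R),
        forall p, U p -> derivable f p (0 : R, 1 : R),
        Ck_on U k' (partial_x f) &
        Ck_on U k' (partial_t f)]
  else forall p, U p -> {for p, continuous f}.

Definition smooth_on (R : realType) (U : set (R * R)) (f : R * R -> R) : Prop :=
  forall k, Ck_on U k f.

(* The library notion quantifies over neighbourhoods of pairs of points.  On
   the diagonal this is the usual local Lipschitz condition; off the diagonal
   it adds nothing, since f is then locally bounded. *)
Definition locally_lipschitz (R : realType) (f : R -> R) : Prop :=
  [locally [lipschitz f x | x in [set: R]]].

(* The values y (x, t) with t < 0 are junk and never used. *)
Record Ecker_Huisken_solution (R : realType) (y0 : R -> R) (y : R * R -> R)
    : Prop := {
  EH_continuous : {within [set p : R * R | 0 <= p.2], continuous y};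
  EH_smooth : smooth_on [set p : R * R | 0 < p.2] y;
  EH_equation : forall p : R * R, 0 < p.2 ->
    partial_t y p = partial_x (partial_x y) p / (1 + partial_x y p ^+ 2);
  EH_initial : forall x : R, y (x, 0) = y0 x;
  EH_locally_uniform :
    {family compact, (fun (t x : R) => y (x, t)) @ 0^'+ --> y0}
}.

(* Main.v *)
(* Let A(x,t) be the area under y(.,t) to the left of x, so that A_x = y and
   A_t = arctan y_x = arctan A_xx.  Since arctan is bounded, A moves by at most
   2t, and the maximum principle with a penalty eps x^2 applies to A although
   nothing is known about y at spatial infinity.
   Heuristically, the area to the left of a point at height h is at least that
   of the self-similar solution in a quadrant, i.e. A >= t F(y / sqrt t) where F
   tends to pi/2 with a Gaussian tail.  Instead of the exact profile we use
   F(h) = pi/2 - gauss_tail(h^2), a subsolution: at an interior minimum of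
   A - t F(y / sqrt t) the slope y_x is determined by y, and the second
   derivative test eliminates y_xx, leaving an ODE inequality for F.
   Applied to A and to the reflected potential A0 - A(-x,t), this gives
   A0 >= 2 t F(y / sqrt t), i.e. pi/2 - A0/(2t) <= gauss_tail(y^2/t), and
   gauss_tail(q) <= exp(-q/4) for large q. *)
Require Import Defs.
From HB Require Import structures.
From mathcomp Require Import all_boot all_order all_algebra.
From mathcomp Require Import all_classical all_reals all_analysis.
From mathcomp Require Import measurable_realfun ring lra.

Set Implicit Arguments.
Unset Strict Implicit.
Unset Printing Implicit Defensive.

Import Order.TTheory GRing.Theory Num.Theory.
Import numFieldNormedType.Exports.

Local Open Scope classical_set_scope.
Local Open Scope ring_scope.

(** * Minimum tests and a penalised minimum principle on the line *)

(** If [l < 0], then [g] is negative just to the right of its zero [x], and the mean value theorem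
    gives [f] a smaller value there. Only the derivative of [g] at [x] itself enters. *)
Lemma derive_ge0_min (R : realType) (f g : R -> R) (x l : R) :
  (forall z : R, is_derive z 1 f (g z)) -> is_derive x 1 g l ->
  (forall z, f x <= f z) -> g x = 0 /\ 0 <= l.
Proof.
move=> df dg fmin.
have gx0 : g x = 0.
  have d0 : is_derive x 1 f 0.
    apply: (@derive1_at_min _ f (x - 1) (x + 1)); first by lra.
    - by move=> t _; have [] := df t.
    - by rewrite in_itv /=; lra.
    - by move=> t _; exact: fmin.
  by have [_ <-] := df x; have [_ ->] := d0.
split=> //; rewrite leNgt; apply/negP => l0.
have [dgx dgE] := dg.
have /cvgrPdist_lt /(_ (- l)) : h^-1 *: (g (h *: 1 + x) - g x) @[h --> 0^'] --> l.
  by rewrite -dgE; exact: dgx.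
rewrite oppr_gt0 => /(_ l0) [e /= e0 He].
have glt0 h : 0 < h -> h < e -> g (h + x) < 0.
  move=> h0 he; have := He h; rewrite /= sub0r normrN gtr0_norm// => /(_ he).
  rewrite gt_eqF// => /(_ isT); rewrite gx0 subr0.
  have -> : h *: (1 : R) = h by rewrite /GRing.scale /= mulr1.
  rewrite /GRing.scale /= ltr_norml => /andP[/[swap] _ H].
  have : h^-1 * g (h + x) < 0 by lra.
  by rewrite pmulr_rlt0 // invr_gt0.
have xe : x < x + e / 2 by lra.
have cf : {within `[x, x + e / 2], continuous f}.
  by apply: derivable_within_continuous => z _; have [] := df z.
have [z zI fE] := MVT xe (fun z _ => df z) cf.
have := fmin (x + e / 2); rewrite -subr_ge0 fE.
have -> : x + e / 2 - x = e / 2 by ring.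
rewrite pmulr_lge0; last by lra.
move: zI; rewrite in_itv /= => /andP[z1 z2].
have := @glt0 (z - x); rewrite subrK; lra.
Qed.

(** The minimum sits at the right end of [(0, t]], so only backward difference quotients are
    compared and the conclusion is an inequality. *)
Lemma left_min_derive_le (R : realType) (f : R -> R) (t l kappa : R) :
  0 < t -> is_derive t 1 f l ->
  (forall s, 0 < s <= t -> f t + kappa * t <= f s + kappa * s) -> l <= - kappa.
Proof.
move=> t0 [df dfE] fmin; rewrite leNgt; apply/negP => kl.
have /cvgrPdist_lt /(_ (l + kappa)) : h^-1 *: (f (h *: 1 + t) - f t) @[h --> 0^'] --> l.
  by rewrite -dfE; exact: df.
have lk : 0 < l + kappa by lra.
move=> /(_ lk) [e /= e0 He].
pose h := Num.min (e / 2) (t / 2).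
have h0 : 0 < h by rewrite lt_min; apply/andP; split; lra.
have he : h <= e / 2 by rewrite ge_min lexx.
have ht : h <= t / 2 by rewrite ge_min lexx orbT.
have := He (- h); rewrite /= sub0r opprK gtr0_norm// => /(_ ltac:(lra)).
rewrite oppr_eq0 gt_eqF// => /(_ isT).
have -> : - h *: (1 : R) = - h by rewrite /GRing.scale /= mulr1.
rewrite /GRing.scale /= ltr_norml => /andP[_ H].
have {}H : - kappa < (- h)^-1 * (f (- h + t) - f t) by lra.
have := fmin (- h + t) ltac:(lra).
move: H; rewrite invrN mulNr ltrN2 -ltr_pdivlMl ?invr_gt0// invrK; lra.
Qed.

(** This replaces compactness in space. The rate [kappa] is fixed before [eps0], so a caller can
    make the spatial penalty as small as needed relative to [kappa]. *)
Lemma penalized_min (R : realType) (Phi : R -> R -> R) (C x0 T : R) :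
  0 < C -> 0 < T ->
  (forall p : R * R, 0 < p.2 -> {for p, continuous (fun p => Phi p.1 p.2)}) ->
  (forall x t, 0 < t -> - (C * t) <= Phi x t) -> Phi x0 T < 0 ->
  exists kappa, 0 < kappa /\ forall eps0, 0 < eps0 ->
  exists eps x t, [/\ 0 < eps <= eps0, 0 < t, Phi x t + eps * x ^+ 2 < 0,
    forall z, Phi x t + eps * x ^+ 2 <= Phi z t + eps * z ^+ 2 &
    forall s, 0 < s <= t -> Phi x t + kappa * t <= Phi x s + kappa * s].
Proof.
move=> C0 T0 cPhi lbPhi Phi0.
(* At [(x0, T)] the spatial and the temporal penalty cost at most [m] each, which leaves a value of
   at most [- m]. *)
pose m := - Phi x0 T / 3.
have m0 : 0 < m by rewrite /m; lra.
exists (m / T); split; first by rewrite divr_gt0.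
move=> eps0 eps00.
pose eps := Num.min eps0 (m / (1 + x0 ^+ 2)).
have x02 : 0 <= x0 ^+ 2 by rewrite sqr_ge0.
have epsgt0 : 0 < eps by rewrite lt_min eps00 divr_gt0//; lra.
have epsx0 : eps * x0 ^+ 2 <= m.
  have : eps * (1 + x0 ^+ 2) <= m.
    by rewrite -ler_pdivlMr; [rewrite ge_min lexx orbT|lra].
  by rewrite mulrDr mulr1; lra.
set k := m / T.
have kT : k * T = m by rewrite /k; field; lra.
have k0 : 0 < k by rewrite divr_gt0.
pose Psi (p : R * R) := Phi p.1 p.2 + eps * p.1 ^+ 2 + k * p.2.
(* Before time [t0] the lower bound keeps [Phi] above [- m / 2], and for [|x| > X] the penalty
   absorbs [C * T]. Hence the minimum over the compact [K] also beats every point outside [K] with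
   time in [(0, T]]. *)
pose t0 := m / (2 * C).
pose X := 1 + `|x0| + C * T / eps.
have t00 : 0 < t0 by rewrite divr_gt0// mulr_gt0.
have Ct0 : C * t0 = m / 2 by rewrite /t0; field; lra.
have mCT : 3 * m <= C * T by have := lbPhi x0 T T0; rewrite /m; lra.
have t0T : t0 <= T by rewrite -(ler_pM2l C0); lra.
have CTe : 0 < C * T / eps by rewrite divr_gt0// mulr_gt0.
have nx0 : 0 <= `|x0| by [].
have X1 : 1 <= X by rewrite /X; lra.
have epsX : C * T <= eps * X ^+ 2.
  have : C * T / eps <= X * X by apply: (@le_trans _ _ X); [rewrite /X; lra|nra].
  by rewrite ler_pdivrMr// expr2; lra.
pose K : set (R * R) := `[- X, X]%classic `*` `[t0, T]%classic.
have Kx0 : K (x0, T).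
  split; rewrite /= in_itv /=; last by rewrite t0T lexx.
  by rewrite -ler_norml /X; lra.
have [|||[x1 t1] /= K1 Pmin] := @compact_EVT_min _ _ Psi K.
- by exists (x0, T).
- by apply: compact_setX; exact: segment_compact.
- apply: continuous_in_subspaceT => -[x t]; rewrite inE => -[_] /=.
  rewrite in_itv /= => /andP[tt0 _].
  have t_gt0 : 0 < t by lra.
  apply: cvgD; last by apply: cvgMr; exact: cvg_snd.
  apply: cvgD; first exact: cPhi.
  by apply: cvgMr; apply: cvgM; exact: cvg_fst.
move: K1; rewrite inE => -[] /=; rewrite !in_itv /= => x1X /andP[t01 t1T].
have Pm : Psi (x1, t1) <= - m.
  apply: le_trans (Pmin (x0, T) _) _; first by rewrite inE.
  by rewrite /Psi /= kT; rewrite /m in epsx0 *; lra.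
have t10 : 0 < t1 by lra.
have kt1 : 0 < k * t1 by rewrite mulr_gt0.
exists eps, x1, t1; split => //.
- by rewrite epsgt0 ge_min lexx.
- by move: Pm; rewrite /Psi /=; lra.
- move=> z; have [zX|zX] := boolP (- X <= z <= X).
    have := Pmin (z, t1); rewrite inE => /(_ _); rewrite /Psi /= => H.
    suff : Phi x1 t1 + eps * x1 ^+ 2 + k * t1 <= Phi z t1 + eps * z ^+ 2 + k * t1 by lra.
    by apply: H; split; rewrite /= in_itv //=; apply/andP.
  have z2 : eps * X ^+ 2 <= eps * z ^+ 2.
    rewrite ler_pM2l// -[z ^+ 2]real_normK ?num_real// lerXn2r ?nnegrE//; first lra.
    by move: zX; rewrite -ler_norml -ltNge; exact: ltW.
  have := lbPhi z t1 t10.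
  have : C * t1 <= C * T by rewrite ler_pM2l.
  by move: Pm; rewrite /Psi /=; lra.
- move=> s /andP[s0 st]; have [ts|ts] := leP t0 s.
    have := Pmin (x1, s); rewrite inE /Psi /= => H.
    suff : Phi x1 t1 + eps * x1 ^+ 2 + k * t1 <= Phi x1 s + eps * x1 ^+ 2 + k * s by lra.
    by apply: H; split; rewrite /= in_itv //=; apply/andP; split=> //; lra.
  have := lbPhi x1 s s0.
  have : C * s < C * t0 by rewrite ltr_pM2l.
  have : 0 <= eps * x1 ^+ 2 by rewrite mulr_ge0 ?sqr_ge0 // ltW.
  have : 0 < k * s by rewrite mulr_gt0.
  by move: Pm; rewrite /Psi /=; lra.
Qed.

(** * Derivative rules in pointwise form, and bounds on arctan *)

Section pointwise_derivatives.
Context {R : realType}.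
Implicit Types (f g : R -> R) (x a df dg : R).

Lemma is_derive_pw_eq f g x df dg :
  is_derive x 1 f df -> f =1 g -> df = dg -> is_derive x 1 g dg.
Proof. by move=> h /funext <- <-. Qed.

Lemma is_derive_addf f g x df dg : is_derive x 1 f df -> is_derive x 1 g dg ->
  is_derive x 1 (fun u : R => f u + g u) (df + dg).
Proof. by move=> hf hg; exact: is_deriveD. Qed.

Lemma is_derive_mulf f g x df dg : is_derive x 1 f df -> is_derive x 1 g dg ->
  is_derive x 1 (fun u : R => f u * g u) (f x * dg + g x * df).
Proof. by move=> hf hg; exact: is_deriveM. Qed.

Lemma is_derive_cmulf f x a df : is_derive x 1 f df ->
  is_derive x 1 (fun u : R => a * f u) (a * df).
Proof. by move=> hf; exact: is_deriveZ. Qed.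

Lemma is_derive_expf f x df : is_derive x 1 f df ->
  is_derive x 1 (fun u : R => expR (f u)) (expR (f x) * df).
Proof. by move=> hf; exact: is_derive1_comp. Qed.

Lemma is_derive_idf x : is_derive x 1 (fun u : R => u) 1.
Proof. exact: is_derive_id. Qed.

Lemma is_derive_lin a x : is_derive x 1 (fun u : R => a * u) a.
Proof.
by refine (is_derive_pw_eq (is_derive_cmulf a (is_derive_idf x)) _ _) => //; rewrite mulr1.
Qed.

Lemma is_derive_invf x : x != 0 -> is_derive x 1 (fun u : R => u^-1) (- x ^- 2).
Proof.
move=> x0; apply: is_derive_eq.
  by apply: (is_deriveV x0); exact: is_derive_idf.
by rewrite /GRing.scale /= mulr1.
Qed.

End pointwise_derivatives.

Lemma atan_lipschitz (R : realType) (a b : R) : a <= b ->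
  0 <= atan b - atan a <= b - a.
Proof.
move=> ab.
have ca : {within `[a, b], continuous (@atan R)}.
  by apply: derivable_within_continuous => z _; have [] := is_derive1_atan z.
have [c _ ->] := MVT_segment ab (fun z _ => is_derive1_atan z) ca.
have c2 : 1 <= 1 + c ^+ 2 by rewrite lerDl sqr_ge0.
have i0 : 0 < (1 + c ^+ 2)^-1 by rewrite invr_gt0; lra.
have i1 : (1 + c ^+ 2)^-1 <= 1 by rewrite invf_le1; lra.
rewrite mulr_ge0 ?subr_ge0 ?(ltW i0)//= ler_piMl ?subr_ge0//.
Qed.

(** For [w > 0] the arctangents of [w] and of its inverse add up to pi/2, and arctan u <= u for u >=
    0. *)
Lemma atan_ge_pihalfB (R : realType) (w : R) : 0 < w -> pi / 2 - w^-1 <= atan w.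
Proof.
move=> w0.
have a0 : 0 < atan w by rewrite -[ltLHS](@atan0 R); exact: lt_atan.
have a1 := atan_ltpi2 w; have pi0 := pi_gt0 R.
have wV : w^-1 = tan (pi / 2 - atan w).
  rewrite -[in LHS](atanK w) /tan -(opprB _ (pi / 2)) sinN cosN.
  by rewrite sinBpihalf cosBpihalf opprK invf_div.
have : atan w^-1 <= w^-1.
  by have := @atan_lipschitz R 0 w^-1 ltac:(by rewrite invr_ge0 ltW); rewrite atan0; lra.
by rewrite {1}wV tanK ?in_itv /=; lra.
Qed.

(** * Derivatives of the Gaussian terms and the inequality for the profile *)

Section gaussian_term.
Context {R : realType}.
Implicit Types (b t x v z : R) (y w : R -> R).

Lemma is_derive_gauss_x b t y x v : t != 0 -> is_derive x 1 y v ->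
  is_derive x 1 (fun u : R => t * expR (- (b * (y u ^+ 2 / t))))
    (- (2 * b * (y x * v) * expR (- (b * (y x ^+ 2 / t))))).
Proof.
move=> t0 dy; refine (is_derive_pw_eq (is_derive_cmulf t (is_derive_expf
  (is_derive_cmulf (- (b / t)) (is_derive_mulf dy dy)))) _ _).
- by move=> u /=; congr (_ * expR _); field.
- have -> : - (b / t) * (y x * y x) = - (b * (y x ^+ 2 / t)) by field.
  by field.
Qed.

Lemma is_derive_gauss_xx b t y w x z : t != 0 ->
  is_derive x 1 y (w x) -> is_derive x 1 w z ->
  is_derive x 1 (fun u : R => - (2 * b * (y u * w u) * expR (- (b * (y u ^+ 2 / t)))))
    (expR (- (b * (y x ^+ 2 / t))) *
     (4 * b ^+ 2 * (y x ^+ 2 / t) * w x ^+ 2 - 2 * b * (w x ^+ 2 + y x * z))).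
Proof.
move=> t0 dy dw; refine (is_derive_pw_eq (is_derive_cmulf (- 2 * b) (is_derive_mulf
  (is_derive_mulf dy dw) (is_derive_expf
    (is_derive_cmulf (- (b / t)) (is_derive_mulf dy dy))))) _ _).
- move=> u /=; have -> : - (b / t) * (y u * y u) = - (b * (y u ^+ 2 / t)) by field.
  by ring.
- have -> : - (b / t) * (y x * y x) = - (b * (y x ^+ 2 / t)) by field.
  by field.
Qed.

Lemma is_derive_gauss_t b y t v : t != 0 -> is_derive t 1 y v ->
  is_derive t 1 (fun s : R => s * expR (- (b * (y s ^+ 2 / s))))
    (expR (- (b * (y t ^+ 2 / t))) *
     (1 + b * (y t ^+ 2 / t) - 2 * b * (y t * v))).
Proof.
move=> t0 dy; refine (is_derive_pw_eq (is_derive_mulf (is_derive_idf t) (is_derive_expf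
  (is_derive_cmulf (- b) (is_derive_mulf (is_derive_mulf dy dy)
    (is_derive_invf t0))))) _ _).
- by move=> s /=; congr (_ * expR _); rewrite mulNr expr2.
- have -> : - b * (y t * y t / t) = - (b * (y t ^+ 2 / t)) by field.
  by field.
Qed.

End gaussian_term.

(* [gauss_tail 0 > pi / 2] makes the barrier negative where [y] is small, and
   [gauss_tail q <= exp (- q / 4)] for large [q] gives the sharp constant; no
   single multiple of [exp (- q / 4)] does both. *)
Definition gauss_tail (R : realType) (q : R) : R :=
  99 / 100 * expR (- (1 / 4 * q)) + 111 / 100 * expR (- (17 / 64 * q)).

(** The tangent of exp at 1 gives e^x >= e x, and e >= (1 + 1/4)^4 = 2.441... *)
Lemma expR_ge_linear (R : realType) (x : R) : 0 <= x -> 244 / 100 * x <= expR x.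
Proof.
move=> x0; have -> : expR x = expR 1 * expR (x - 1) by rewrite -expRD subrKC.
have e1 : 244 / 100 <= expR (1 : R).
  have -> : (1 : R) = 4%:R * (1 / 4) by field.
  rewrite expRM_natl.
  have := @lerXn2r R 4 (5 / 4) (expR (1 / 4)).
  rewrite !nnegrE expR_ge0 => /(_ ltac:(lra) isT).
  have := @expR_ge1Dx R (1 / 4); lra.
have := @expR_ge1Dx R (x - 1).
have -> : 1 + (x - 1) = x by ring.
by move=> h; apply: ler_pM => //; lra.
Qed.

(** A term e^(-bq) contributes the surplus (1 - 2b) + b (1 - 4b) q times itself. For b = 1/4 this is
    the constant 1/2. For b = 17/64 the coefficient of q is -17/1024, and the first term compensates
    because [E1 = E2 * expR (q / 64)] dominates a multiple of [E2 * q]. *)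
Lemma gauss_tail_supersolution (R : realType) (q E1 E2 : R) : 0 <= q ->
  E1 = expR (- (1 / 4 * q)) -> E2 = expR (- (17 / 64 * q)) ->
  99 / 100 * E1 * (2 * (1 / 4) + 4 * (1 / 4) ^+ 2 * q) +
  111 / 100 * E2 * (2 * (17 / 64) + 4 * (17 / 64) ^+ 2 * q) <=
  99 / 100 * E1 * (1 + 1 / 4 * q) + 111 / 100 * E2 * (1 + 17 / 64 * q).
Proof.
move=> q0 E1E E2E.
have E12 : E1 = E2 * expR (q / 64) by rewrite E1E E2E -expRD; congr expR; field.
have := @expR_ge_linear R (q / 64) ltac:(lra).
have E20 : 0 < E2 by rewrite E2E expR_gt0.
rewrite -(ler_pM2l E20) -E12 => h.
have : 0 <= E2 * q by rewrite mulr_ge0 // ltW.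
lra.
Qed.

(** * Comparison of potentials with the barrier *)

(* [A] is the left area of the graph of [y]; [w] and [z] stand for [y_x] and
   [y_xx].  The last field replaces the initial condition [A (., 0) >= 0]. *)
Record csf_potential (R : realType) (A y w z : R -> R -> R) : Prop := {
  pot_continuous : forall p : R * R, 0 < p.2 ->
    {for p, continuous (fun p => A p.1 p.2)};
  slope_continuous : forall p : R * R, 0 < p.2 ->
    {for p, continuous (fun p => y p.1 p.2)};
  pot_dx : forall x t : R, 0 < t -> is_derive x 1 (A ^~ t) (y x t);
  slope_dx : forall x t : R, 0 < t -> is_derive x 1 (y ^~ t) (w x t);
  slope_dxx : forall x t : R, 0 < t -> is_derive x 1 (w ^~ t) (z x t);
  pot_dt : forall x t : R, 0 < t -> is_derive t 1 (A x) (atan (w x t));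
  slope_dt : forall x t : R, 0 < t ->
    is_derive t 1 (y x) (z x t / (1 + w x t ^+ 2));
  pot_ge_initial : forall x t : R, 0 < t -> - (2 * t) <= A x t
}.

Lemma is_derive_penalty (R : realType) (f : R -> R) (eps x df : R) :
  is_derive x 1 f df ->
  is_derive x 1 (fun u : R => f u + eps * u ^+ 2) (df + 2 * eps * x).
Proof.
move=> dfx; refine (is_derive_pw_eq (is_derive_addf dfx (is_derive_cmulf eps
  (is_derive_mulf (is_derive_idf x) (is_derive_idf x)))) _ _).
  by move=> u /=; rewrite expr2.
by ring.
Qed.

Lemma is_derive_penalty_dx (R : realType) (f : R -> R) (eps x df : R) :
  is_derive x 1 f df ->
  is_derive x 1 (fun u : R => f u + 2 * eps * u) (df + 2 * eps).
Proof.
move=> dfx; exact: is_derive_addf dfx (is_derive_lin (2 * eps) x).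
Qed.

(** Zero is the first barrier: at a penalised negative minimum [w >= - 2 * e], so arctan w >= - k /
    2, while the time derivative there is at most [- k]. *)
Lemma pot_ge0 (R : realType) (A y w z : R -> R -> R) :
  csf_potential A y w z -> forall x t : R, 0 < t -> 0 <= A x t.
Proof.
move=> [cA _ dA dy _ At _ lb] x0 T T0; rewrite leNgt; apply/negP => A0.
have [k [k0 H]] := penalized_min (ltr0Sn _ 1) T0 cA lb A0.
have [e [x [t [/andP[e0 ek] t0 _ minx mint]]]] := H (k / 4) ltac:(lra).
have [_ wge] := derive_ge0_min
  (fun u => is_derive_penalty e (dA u t t0))
  (is_derive_penalty_dx e (dy x t t0)) minx.
have := left_min_derive_le t0 (At x t t0) mint.
have [w0|w0] := leP 0 (w x t).
  by have := atan_lipschitz w0; rewrite atan0; lra.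
by have := atan_lipschitz (ltW w0); rewrite atan0; lra.
Qed.


(* [x], [y], [w], [z], [th] are the position, height, [y_x], [y_xx] and
   [arctan y_x] at a minimum of [A - t F] + penalty, and [G], [P], [S] come from
   [gauss_tail].  Since [P w] is close to [1], the terms in [w] almost cancel. *)
Lemma barrier_contact (R : realType) (w y z x q t eps k s G P S p th : R) :
  0 < eps -> eps <= k / 8 -> 80 * eps <= s ^+ 2 -> 0 <= s -> s <= 1 / 2 ->
  s <= k / 8 -> 0 < P -> P <= 11 / 10 -> 0 < t -> t / 10 <= y ^+ 2 ->
  0 <= S * q -> P + S * q <= G + P / 2 * q -> eps * x ^+ 2 <= 2 * t ->
  y - P * (y * w) + 2 * eps * x = 0 ->
  0 <= w - P * (w ^+ 2 + y * z) + S * q * w ^+ 2 + 2 * eps ->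
  (0 < w -> p - w^-1 <= th) ->
  th - p + G + P / 2 * q - P * (y * (z / (1 + w ^+ 2))) <= - k -> False.
Proof.
move=> e0 ek es s0 s1 sk P0 P1 t0 yt Sq0 PG ex c1 c2 thw c3.
have y20 : 0 < y ^+ 2 by apply: lt_le_trans yt; lra.
have y0 : y != 0 by move: y20; apply: contraTneq => ->; rewrite expr0n ltxx.
(* [sg] is the error in [P * w = 1] caused by the spatial penalty. It is at most [s] in size because
   [eps * x ^+ 2 <= 2 * t <= 20 * y ^+ 2]. *)
pose sg := 2 * eps * x / y.
have sgy : sg * y = 2 * eps * x by rewrite /sg; field.
have sgs : `|sg| <= s.
  rewrite -(@ler_pXn2r _ 2) ?nnegrE// real_normK ?num_real//.
  rewrite -(ler_pM2r y20) -exprMn sgy.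
  have : eps * (eps * x ^+ 2) <= eps * (20 * y ^+ 2).
    by apply: ler_wpM2l; [exact: ltW|lra].
  have : 80 * eps * y ^+ 2 <= s ^+ 2 * y ^+ 2 by apply: ler_wpM2r => //; exact: ltW.
  by rewrite !exprMn; lra.
move: sgs; rewrite ler_norml => /andP[sg1 sg2].
have Pw : P * w = 1 + sg.
  apply: (mulIf y0); rewrite mulrDl mul1r sgy; move: c1; lra.
have w0 : 0 < w by rewrite -(pmulr_rgt0 _ P0) Pw; lra.
have wV : w^-1 <= P * (1 + 2 * s).
  rewrite -[leLHS]mul1r ler_pdivrMr// mulrAC Pw; nra.
have {}thw := thw w0.
have w20 : 0 <= w ^+ 2 by exact: sqr_ge0.
have ww : w <= 1 + w ^+ 2 by have := sqr_ge0 (w - 1); rewrite expr2; lra.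
(* In the second-order condition [P * w ^+ 2 = w + sg * w], so the leading [w] cancels. The
   remainder [s * w] is absorbed by [1 + w ^+ 2]. *)
have Pyz : P * (y * (z / (1 + w ^+ 2))) <= s + S * q + 2 * eps.
  have -> : P * (y * (z / (1 + w ^+ 2))) = P * (y * z) / (1 + w ^+ 2).
    by field; rewrite gt_eqF//; lra.
  rewrite ler_pdivrMr; last by lra.
  have : P * (w ^+ 2) = w + sg * w by rewrite expr2 mulrA Pw; ring.
  have : - (sg * w) <= s * w by rewrite -mulNr ler_pM2r//; lra.
  have : s * w <= s * (1 + w ^+ 2) by apply: ler_wpM2l.
  have : 0 <= eps * w ^+ 2 by rewrite mulr_ge0// ltW.
  move: c2; lra.
(* The errors add up to 3.2 s + 2 eps <= 0.65 k, short of the required [k]. *)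
have Ps : P * (1 + 2 * s) <= P + 22 / 10 * s by nra.
lra.
Qed.

(** At q = 0 the value is 2.1 > 2 > pi/2, and the tangent bound exp(x) >= 1 + x keeps it above pi/2
    for small q. This keeps contact points away from [y = 0]. *)
Lemma gauss_tail_lt_pihalf (R : realType) (q : R) : 0 <= q ->
  gauss_tail q < pi / 2 -> 1 / 10 <= q.
Proof.
move=> q0 Gq; have p2 := pihalf_lt2 R.
have e1 := @expR_ge1Dx R (- (1 / 4 * q)).
have e2 := @expR_ge1Dx R (- (17 / 64 * q)).
by move: Gq; rewrite /gauss_tail; lra.
Qed.

(** The bound [pot_ge0] enters twice: it gives [Phi] the lower bound required by [penalized_min],
    and it forces [q >= 1 / 10] at a contact point. *)
Lemma pot_ge_barrier (R : realType) (A y w z : R -> R -> R) :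
  csf_potential A y w z -> forall x t : R, 0 < t ->
  t * (pi / 2 - gauss_tail (y x t ^+ 2 / t)) <= A x t.
Proof.
move=> pA x0 T T0; have A_ge0 := pot_ge0 pA.
case: pA => cA cy dA dy dw At yt lb.
pose E b x t := expR (- (b * (y x t ^+ 2 / t))).
pose Phi x t := A x t + - (pi / 2) * t +
  (99 / 100 * (t * E (1 / 4) x t) + 111 / 100 * (t * E (17 / 64) x t)).
have PhiE x t : Phi x t = A x t - t * (pi / 2 - gauss_tail (y x t ^+ 2 / t)).
  by rewrite /Phi /gauss_tail /E; ring.
have Egt0 b x t : 0 < E b x t by rewrite expR_gt0.
have pih := pihalf_lt2 R.
rewrite -subr_ge0 -PhiE leNgt; apply/negP => Phi0.
have cPhi (p : R * R) : 0 < p.2 -> {for p, continuous (fun p => Phi p.1 p.2)}.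
  move=> p0.
  have ct : {for p, continuous (fun p : R * R => p.2)} by exact: cvg_snd.
  have cE b : {for p, continuous (fun p : R * R => p.2 * E b p.1 p.2)}.
    apply: cvgM; first exact: ct.
    apply: (@continuous_comp _ _ _
      (fun p : R * R => - (b * (y p.1 p.2 ^+ 2 / p.2))) expR); last first.
      exact: continuous_expR.
    apply: cvgN; apply: cvgMr; apply: cvgM.
      by apply: cvgM; exact: cy.
    by apply: cvgV; [rewrite gt_eqF|exact: ct].
  apply: cvgD; first by apply: cvgD; [exact: cA|apply: cvgMr; exact: ct].
  by apply: cvgD; apply: cvgMr; exact: cE.
have lbPhi x t : 0 < t -> - (2 * t) <= Phi x t.
  move=> t0; have := A_ge0 x t t0.
  have := mulr_gt0 t0 (Egt0 (1 / 4) x t); have := mulr_gt0 t0 (Egt0 (17 / 64) x t).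
  have : pi / 2 * t <= 2 * t by rewrite ler_pM2r// ltW.
  by rewrite /Phi; lra.
have [k [k0 H]] := penalized_min (ltr0Sn _ 1) T0 cPhi lbPhi Phi0.
(* [s] is the tolerance for the penalty error in [barrier_contact]; [s ^+ 2 / 80] is the size of
   [eps] that guarantees it. *)
pose s := Num.min (1 / 2) (k / 8).
have s0 : 0 < s by rewrite lt_min; apply/andP; split; lra.
have s1 : s <= 1 / 2 by rewrite ge_min lexx.
have sk : s <= k / 8 by rewrite ge_min lexx orbT.
have ss0 : 0 < s ^+ 2 by rewrite exprn_gt0.
have [|e [x [t [/andP[e0 ek] t0 Phin minx mint]]]] := H (Num.min (k / 8) (s ^+ 2 / 80)).
  by rewrite lt_min; apply/andP; split; lra.
have {}ek : e <= k / 8 /\ 80 * e <= s ^+ 2.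
  by move: ek; rewrite le_min => /andP[]; lra.
have t_neq0 : t != 0 by rewrite gt_eqF.
(* [d1], [d2], [d3] differentiate [Phi] once in x, twice in x and once in t, following the order of
   its summands. The zero constant in [d2] is the x-derivative of the term constant in x. *)
have d1 (u : R) := is_derive_addf (is_derive_addf (dA u t t0)
  (is_derive_cst (- (pi / 2) * t) u (1 : R)))
  (is_derive_addf
    (is_derive_cmulf (99 / 100) (is_derive_gauss_x (1 / 4) t_neq0 (dy u t t0)))
    (is_derive_cmulf (111 / 100) (is_derive_gauss_x (17 / 64) t_neq0 (dy u t t0)))).
have d2 := is_derive_addf (is_derive_addf (dy x t t0)
  (is_derive_cst (0 : R) x (1 : R)))
  (is_derive_addf
    (is_derive_cmulf (99 / 100) (is_derive_gauss_xx (1 / 4) t_neq0 (dy x t t0) (dw x t t0)))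
    (is_derive_cmulf (111 / 100) (is_derive_gauss_xx (17 / 64) t_neq0 (dy x t t0) (dw x t t0)))).
have d3 := is_derive_addf (is_derive_addf (At x t t0)
  (is_derive_cmulf (- (pi / 2)) (is_derive_idf t)))
  (is_derive_addf
    (is_derive_cmulf (99 / 100) (is_derive_gauss_t (1 / 4) t_neq0 (yt x t t0)))
    (is_derive_cmulf (111 / 100) (is_derive_gauss_t (17 / 64) t_neq0 (yt x t t0)))).
have [c1 c2] := derive_ge0_min (fun u => is_derive_penalty e (d1 u))
  (is_derive_penalty_dx e d2) minx.
have c3 := left_min_derive_le t0 d3 mint.
set q := y x t ^+ 2 / t in c1 c2 c3.
have q0 : 0 <= q by rewrite divr_ge0 ?sqr_ge0 // ltW.
have E1E : E (1 / 4) x t = expR (- (1 / 4 * q)) by [].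
have E2E : E (17 / 64) x t = expR (- (17 / 64 * q)) by [].
have Gsup := gauss_tail_supersolution q0 E1E E2E.
rewrite -E1E -E2E in c1 c2 c3.
have q1 : 1 / 10 <= q.
  apply: gauss_tail_lt_pihalf => //.
  rewrite -subr_gt0 -(pmulr_rgt0 _ t0).
  have := A_ge0 x t t0; have := PhiE x t; rewrite -/q.
  have : 0 <= e * x ^+ 2 by rewrite mulr_ge0 ?sqr_ge0// ltW.
  clear -Phin; lra.
have yq : t / 10 <= y x t ^+ 2.
  by move: q1; rewrite /q ler_pdivlMr// mulrC div1r.
have ex : e * x ^+ 2 <= 2 * t by have := lbPhi x t t0; clear -Phin; move=> *; lra.
have {}E11 : E (1 / 4) x t <= 1 by rewrite E1E expR_le1; clear -q0; lra.
have {}E21 : E (17 / 64) x t <= 1 by rewrite E2E expR_le1; clear -q0; lra.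
have E10 := Egt0 (1 / 4) x t; have E20 := Egt0 (17 / 64) x t.
have aw := @atan_ge_pihalfB R (w x t).
have [ek1 ek2] := ek; have s0' := ltW s0.
clear -e0 ek1 ek2 s0' s1 sk t0 yq Gsup ex c1 c2 c3 aw E11 E21 E10 E20 q0.
move: (E (1 / 4) x t) (E (17 / 64) x t) Gsup c1 c2 c3 E11 E21 E10 E20.
move=> E1 E2 Gsup c1 c2 c3 E11 E21 E10 E20.
clearbody q.
(* With G = [gauss_tail], the three sums are G(q), -2 G'(q) and 4 G''(q). *)
apply: (@barrier_contact R (w x t) (y x t) (z x t) x q t e k s
  (99 / 100 * E1 + 111 / 100 * E2)
  (2 * (99 / 100 * (1 / 4) * E1 + 111 / 100 * (17 / 64) * E2))
  (4 * (99 / 100 * (1 / 4) ^+ 2 * E1 + 111 / 100 * (17 / 64) ^+ 2 * E2))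
  (pi / 2) (atan (w x t))) => //.
- clear -E10 E20; lra.
- clear -E11 E21; lra.
- by apply: mulr_ge0 => //; clear -E10 E20; lra.
- clear -Gsup; lra.
- clear -c1; lra.
- clear -c2; lra.
- clear -c3; lra.
Qed.

(** * Integrals over the unit interval depending on a parameter *)

Section unit_integral.
Context {R : realType}.
Notation mu := (@lebesgue_measure R).
Implicit Types (f g : R -> R -> R) (a d r u : R).

Lemma integrable_unit (h : R -> R) : continuous h ->
  mu.-integrable `[0, 1] (EFin \o h).
Proof.
move=> ch; apply: continuous_compact_integrable; first exact: segment_compact.
exact: continuous_subspaceT.
Qed.

Lemma continuous_pair f u r : {for (u, r), continuous (fun p : R * R => f p.1 p.2)} ->
  {for u, continuous (f ^~ r)} /\ {for r, continuous (f u)}.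
Proof.
move=> cf; split.
  by apply: (@continuous2_cvg R R R R _ _ id (fun=> r) f u r cf); [exact: cvg_id|exact: cvg_cst].
by apply: (@continuous2_cvg R R R R _ _ (fun=> u) id f u r cf); [exact: cvg_cst|exact: cvg_id].
Qed.

(** This supplies the constant dominating function for continuity and differentiation under the
    integral. *)
Lemma bounded_near_unit f a d : 0 < d ->
  (forall u r, `|u - a| <= d -> {for (u, r), continuous (fun p : R * R => f p.1 p.2)}) ->
  exists M, 0 <= M /\ forall u r, u \in `]a - d, a + d[ -> r \in `[0, 1] ->
    `|f u r| <= M.
Proof.
move=> d0 cf.
pose K : set (R * R) := `[a - d, a + d]%classic `*` `[0, 1]%classic.
have [|||[u1 r1] _ Mmax] := @compact_EVT_max _ _ (fun p : R * R => `|f p.1 p.2|) K.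
- by exists (a, 0); split; rewrite /= in_itv /=; lra.
- by apply: compact_setX; exact: segment_compact.
- apply: continuous_in_subspaceT => -[u r]; rewrite inE => -[/= + _].
  rewrite in_itv /= => ua.
  apply: (@continuous_comp _ _ _ (fun p : R * R => f p.1 p.2) (@Num.norm _ R)).
    by apply: cf; rewrite ler_norml; lra.
  exact: norm_continuous.
exists `|f u1 r1|; split=> // u r ua rI.
have := Mmax (u, r); rewrite inE; apply; split => //=.
by move: ua; rewrite !in_itv /=; lra.
Qed.

Lemma continuous_unit_integral f a d : 0 < d ->
  (forall u r, `|u - a| <= d -> {for (u, r), continuous (fun p : R * R => f p.1 p.2)}) ->
  {for a, continuous (fun u => \int[mu]_(r in `[0, 1]) f u r)}.
Proof.
move=> d0 cf; have [M [M0 fM]] := bounded_near_unit d0 cf.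
have near_a u : `]a - d, a + d[%classic u -> `|u - a| <= d.
  by rewrite /= in_itv /= ler_norml; lra.
apply: (@continuity_under_integral R _ _ mu f `[0, 1]%classic _ (a - d) (a + d) _ _ (cst M)).
- exact: measurable_itv.
- by move=> u /near_a ua; apply: integrable_unit => r; exact: (continuous_pair (cf u r ua)).2.
- by apply: aeW => r _ u; rewrite inE => /near_a ua; exact: (continuous_pair (cf u r ua)).1.
- by apply: integrable_unit => r; exact: cst_continuous.
- by move=> u ua; apply: aeW => r rI; exact: fM.
- by rewrite inE /= in_itv /=; lra.
Qed.

Lemma is_derive_unit_integral f g a d : 0 < d ->
  (forall u r, `|u - a| <= d -> is_derive u 1 (f ^~ r) (g u r)) ->
  (forall u r, `|u - a| <= d -> {for (u, r), continuous (fun p : R * R => f p.1 p.2)}) ->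
  (forall u r, `|u - a| <= d -> {for (u, r), continuous (fun p : R * R => g p.1 p.2)}) ->
  is_derive a 1 (fun u => \int[mu]_(r in `[0, 1]) f u r)
    (\int[mu]_(r in `[0, 1]) g a r).
Proof.
move=> d0 df cf cg; have [M [M0 gM]] := bounded_near_unit d0 cg.
have near_a u : `]a - d, a + d[%classic u -> `|u - a| <= d.
  by rewrite /= in_itv /= ler_norml; lra.
have aI : `]a - d, a + d[%classic a by rewrite /= in_itv /=; lra.
have intf u : `]a - d, a + d[%classic u -> mu.-integrable `[0, 1] (EFin \o f u).
  by move=> /near_a ua; apply: integrable_unit => r; exact: (continuous_pair (cf u r ua)).2.
have dfE u r : `|u - a| <= d -> partial1of2 f u r = g u r.
  by move=> ua; rewrite partial1of2E; have [_ ->] := df u r ua.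
have derf u r : `]a - d, a + d[%classic u -> `[0, 1]%classic r -> derivable (f ^~ r) u 1.
  by move=> /near_a ua _; have [] := df u r ua.
have ub u r : `]a - d, a + d[%classic u -> `[0, 1]%classic r ->
    `|partial1of2 f u r| <= cst M r.
  by move=> ua rI; rewrite dfE; [exact: gM|exact: near_a].
have intM : mu.-integrable `[0, 1] (EFin \o cst M).
  by apply: integrable_unit => r; exact: cst_continuous.
apply: DeriveDef.
  exact: (@derivable_under_integral R _ _ mu f _ (measurable_itv _) a _ _ aI intf derf
    (cst M) (fun=> M0) intM ub).
rewrite -derive1E.
rewrite (@differentiation_under_integral R _ _ mu f _ (measurable_itv _) a _ _ aI intf derf
  (cst M) (fun=> M0) intM ub).
by apply: eq_Rintegral => r _; apply: dfE; rewrite subrr normr0 ltW.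
Qed.

Lemma unit_integral_FTC2 (F f : R -> R) :
  (forall r : R, is_derive r 1 F (f r)) -> continuous f ->
  \int[mu]_(r in `[0, 1]) f r = F 1 - F 0.
Proof.
move=> dF cf.
have cF : continuous F.
  move=> r; apply: differentiable_continuous; apply/derivable1_diffP.
  by have [] := dF r.
rewrite /Rintegral (@continuous_FTC2 R f F 0 1) //.
- exact: continuous_subspaceT.
- split; first by move=> r _; have [] := dF r.
    by apply: cvg_at_right_filter; exact: cF.
  by apply: cvg_at_left_filter; exact: cF.
- by move=> r _; rewrite derive1E; have [_ ->] := dF r.
Qed.

End unit_integral.

(** * From partial derivatives to slices and joint continuity *)

Lemma is_derive_partial_x (R : realType) (f : R * R -> R) (x t : R) :
  derivable f (x, t) (1 : R, 0 : R) ->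
  is_derive x 1 (fun u : R => f (u, t)) (partial_x f (x, t)).
Proof.
have E : (fun h : R => h^-1 *: (f (h *: (1 : R, 0 : R) + (x, t)) - f (x, t))) =
    (fun h : R => h^-1 *: (((fun u : R => f (u, t)) \o shift x) (h *: (1 : R)) - f (x, t))).
  apply/funext => h /=; congr (_ *: (f _ - _)).
  by congr pair => /=; rewrite scaler0 add0r.
by rewrite /derivable => df; split; rewrite /partial_x /derivable /derive -E.
Qed.

Lemma is_derive_partial_t (R : realType) (f : R * R -> R) (x t : R) :
  derivable f (x, t) (0 : R, 1 : R) ->
  is_derive t 1 (fun s : R => f (x, s)) (partial_t f (x, t)).
Proof.
have E : (fun h : R => h^-1 *: (f (h *: (0 : R, 1 : R) + (x, t)) - f (x, t))) =
    (fun h : R => h^-1 *: (((fun s : R => f (x, s)) \o shift t) (h *: (1 : R)) - f (x, t))).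
  apply/funext => h /=; congr (_ *: (f _ - _)).
  by congr pair => /=; rewrite scaler0 add0r.
by rewrite /derivable => df; split; rewrite /partial_t /derivable /derive -E.
Qed.

Section smooth_slices.
Context {R : realType} (y : R * R -> R).
Hypothesis sm : smooth_on [set p : R * R | 0 < p.2] y.
Implicit Types (x t : R) (p : R * R).

Lemma smooth_continuous p : 0 < p.2 -> {for p, continuous y}.
Proof. exact: (sm 0). Qed.

Lemma smooth_continuous_x p : 0 < p.2 -> {for p, continuous (partial_x y)}.
Proof. by have [_ _ /= h _] := sm 1; exact: h. Qed.

Lemma smooth_continuous_t p : 0 < p.2 -> {for p, continuous (partial_t y)}.
Proof. by have [_ _ /= _ h] := sm 1; exact: h. Qed.

Lemma smooth_dx x t : 0 < t -> is_derive x 1 (fun u : R => y (u, t)) (partial_x y (x, t)).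
Proof. by move=> t0; apply: is_derive_partial_x; have [h _ _ _] := sm 1; exact: h. Qed.

Lemma smooth_dt x t : 0 < t -> is_derive t 1 (fun s : R => y (x, s)) (partial_t y (x, t)).
Proof. by move=> t0; apply: is_derive_partial_t; have [_ h _ _] := sm 1; exact: h. Qed.

Lemma smooth_dxx x t : 0 < t ->
  is_derive x 1 (fun u : R => partial_x y (u, t)) (partial_x (partial_x y) (x, t)).
Proof.
by move=> t0; apply: is_derive_partial_x; have [_ _ [h _ _ _] _] := sm 2; exact: h.
Qed.

End smooth_slices.

Lemma is_derive_atanf (R : realType) (f : R -> R) (x df : R) : is_derive x 1 f df ->
  is_derive x 1 (fun u : R => atan (f u)) (df / (1 + f x ^+ 2)).
Proof. by move=> hf; rewrite mulrC; exact: is_derive1_comp. Qed.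

Lemma continuous_slice (R : realType) (f : R * R -> R) (g h : R * R -> R) (p : R * R) :
  {for (g p, h p), continuous f} ->
  {for p, continuous g} -> {for p, continuous h} ->
  {for p, continuous (fun p => f (g p, h p))}.
Proof.
move=> cf cg ch.
apply: (@continuous2_cvg _ R R R _ _ g h (fun a b => f (a, b)) (g p) (h p)) => //.
by apply: cvg_trans cf; apply: near_eq_cvg; apply: nearW => -[].
Qed.

Lemma mean_value_bound (R : realType) (f df : R -> R) (a b M : R) :
  (forall u : R, `|u - a| <= `|b - a| -> is_derive u 1 f (df u) /\ `|df u| <= M) ->
  `|f b - f a| <= M * `|b - a|.
Proof.
move=> dfM.
have M0 : 0 <= M by have [_] := dfM a ltac:(by rewrite subrr normr0); apply: le_trans.
have cf (u v : R) : (forall s : R, s \in `[u, v] -> is_derive s 1 f (df s)) ->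
    {within `[u, v], continuous f}.
  by move=> h; apply: derivable_within_continuous => s /h[].
have [ab|ba|->] := ltgtP a b; last by rewrite !subrr normr0 mulr0.
- have abE : `|b - a| = b - a by rewrite gtr0_norm ?subr_gt0.
  have h (u : R) : u \in `[a, b] -> is_derive u 1 f (df u) /\ `|df u| <= M.
    by rewrite in_itv /= => /andP[? ?]; apply: dfM; rewrite abE ger0_norm; lra.
  have [|u uI ->] := @MVT _ f df _ _ ab _ (cf _ _ (fun s sI => (h s sI).1)).
    by move=> u uI; apply: (h u _).1; exact: subset_itv_oo_cc.
  rewrite normrM; apply: ler_wpM2r => //.
  by apply: (h u _).2; exact: subset_itv_oo_cc.
- have abE : `|b - a| = a - b by rewrite ltr0_norm ?subr_lt0// opprB.
  have h (u : R) : u \in `[b, a] -> is_derive u 1 f (df u) /\ `|df u| <= M.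
    by rewrite in_itv /= => /andP[? ?]; apply: dfM; rewrite abE ler0_norm; lra.
  have [|u uI E] := @MVT _ f df _ _ ba _ (cf _ _ (fun s sI => (h s sI).1)).
    by move=> u uI; apply: (h u _).1; exact: subset_itv_oo_cc.
  rewrite distrC E normrM (distrC b); apply: ler_wpM2r => //.
  by apply: (h u _).2; exact: subset_itv_oo_cc.
Qed.

(** Go from [(x, t)] to [(x, t')] and then to [(x', t')]: the first increment is controlled by the
    global bound [M], the second by a local bound [N] that continuity of [y] provides. *)
Lemma continuous_of_partials (R : realType) (A y v : R -> R -> R) (M : R) (p : R * R) :
  (forall x t : R, 0 < t -> is_derive x 1 (A ^~ t) (y x t)) ->
  (forall x t : R, 0 < t -> is_derive t 1 (A x) (v x t)) ->
  (forall x t, 0 < t -> `|v x t| <= M) -> 0 < p.2 ->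
  {for p, continuous (fun p => y p.1 p.2)} ->
  {for p, continuous (fun p => A p.1 p.2)}.
Proof.
case: p => x t dA dv vM /= t0 cy.
have M0 : 0 <= M by apply: le_trans (vM x t t0).
pose N := `|y x t| + 1.
have N0 : 0 < N by rewrite ltr_wpDl.
have /cvgrPdist_lt /(_ _ ltr01) /nbhs_ballP[e /= e0 He] := cy.
have yN x' t' : `|x' - x| < e -> `|t' - t| < e -> `|y x' t'| <= N.
  move=> xe te; have : `|y x t - y x' t'| < 1.
    by apply: (He (x', t')); split; rewrite /ball /= distrC.
  move=> h; rewrite -[y x' t'](subrK (y x t)) /N addrC (le_trans (ler_normD _ _))//.
  by rewrite lerD2l distrC ltW.
apply/cvgrPdist_le => d d0.
pose k := d / (N + M).
have k0 : 0 < k by rewrite divr_gt0//; lra.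
have kE : (N + M) * k = d by rewrite /k; field; lra.
pose r := Num.min e (Num.min t k).
have r0 : 0 < r by rewrite !lt_min e0 t0 k0.
exists (ball x r, ball t r); first by split; exact: nbhsx_ballx.
move=> [x' t'] [] /=; rewrite /ball /= distrC (distrC t) /r !lt_min.
move=> /and3P[x1 x2 x3] /and3P[t1 t2 t3].
have b1 : `|A x t' - A x t| <= M * `|t' - t|.
  apply: mean_value_bound => u hu; have u0 : 0 < u.
    by have := le_lt_trans hu t2; rewrite ltr_norml; lra.
  by split; [exact: dv|exact: vM].
have t'0 : 0 < t' by move: t2; rewrite ltr_norml; lra.
have b2 : `|A x' t' - A x t'| <= N * `|x' - x|.
  apply: (@mean_value_bound _ (A ^~ t') (y ^~ t')) => u hu; split; first exact: dA.
  by apply: yN => //; exact: le_lt_trans hu x1.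
rewrite distrC; have -> : A x' t' - A x t = (A x' t' - A x t') + (A x t' - A x t) by ring.
apply: le_trans (ler_normD _ _) _.
have : M * `|t' - t| <= M * k by apply: ler_wpM2l => //; exact: ltW.
have : N * `|x' - x| <= N * k by apply: ler_wpM2l => //; exact: ltW.
lra.
Qed.

(** * Area between 0 and x, and the flux through 0 *)

Section EH_mass.
Context {R : realType} (y0 : R -> R) (y : R * R -> R).
Hypothesis EH : Ecker_Huisken_solution y0 y.
Notation mu := (@lebesgue_measure R).
Implicit Types (x t s r : R).

Let sm := EH_smooth EH.

(** Even reflection in time turns continuity on the closed half-plane into continuity on the whole
    plane, so that two-sided limits at time 0 can be used. *)
Lemma EH_continuous_abs (p : R * R) :
  {for p, continuous (fun p : R * R => y (p.1, `|p.2|))}.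
Proof.
have cy := (subspace_continuousP _ _).1 (EH_continuous EH) (p.1, `|p.2|) (normr_ge0 _).
apply: (@cvg_comp _ _ _ (fun p : R * R => (p.1, `|p.2|)) y _ _ _ _ cy) => B /= wB.
have cphi : {for p, continuous (fun p : R * R => (p.1, `|p.2|))}.
  apply: (@cvg_pair _ _ _ (nbhs p) (nbhs p.1) (nbhs `|p.2|) _ _ _ fst (fun p => `|p.2|)).
    exact: cvg_fst.
  apply: (@continuous_comp _ _ _ snd (@Num.norm _ R)); first exact: cvg_snd.
  exact: norm_continuous.
have := cphi _ wB; rewrite /nbhs /=; apply: filterS => q; apply; exact: normr_ge0.
Qed.

Lemma EH_initial_continuous : continuous y0.
Proof.
move=> x; have -> : y0 = fun u => y (u, `|0 : R|).
  by apply/funext => u; rewrite normr0 (EH_initial EH).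
by have [h _] := @continuous_pair R (fun u s => y (u, `|s|)) _ _ (@EH_continuous_abs (x, 0)); exact: h.
Qed.

(* The integral of [y (., t)] from [0] to [x], over a fixed domain so that it
   can be differentiated in [x] and in [t] in the same way. *)
Definition EH_mass x t : R := \int[mu]_(r in `[0, 1]) (x * y (x * r, t)).

Lemma EH_mass_dx x t : 0 < t -> is_derive x 1 (EH_mass ^~ t) (y (x, t)).
Proof.
move=> t0.
(* [g] is both the u-derivative of [u * y (u * r, t)] and the r-derivative of [r * y (u * r, t)], so
   its integral over the unit interval is [y (u, t)]. *)
pose g u r := y (u * r, t) + u * (r * partial_x y (u * r, t)).
have dcomp (u r : R) : is_derive u 1 (fun v : R => y (v * r, t)) (r * partial_x y (u * r, t)).
  have dr : is_derive u 1 (fun v : R => v * r) r.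
    by refine (is_derive_pw_eq (is_derive_lin r u) _ _) => // v; rewrite mulrC.
  have dy := smooth_dx sm (u * r) t0.
  by refine (is_derive_pw_eq (@is_derive1_comp _ _ ( *%R^~ r) u _ _ dy dr) _ _) => //; rewrite mulrC.
have cmul (p : R * R) : {for p, continuous (fun p : R * R => p.1 * p.2)}.
  by apply: cvgM; [exact: cvg_fst|exact: cvg_snd].
have cyx (f : R * R -> R) (p : R * R) : (forall p : R * R, 0 < p.2 -> {for p, continuous f}) ->
    {for p, continuous (fun p : R * R => f (p.1 * p.2, t))}.
  move=> cf; apply: (@continuous_slice _ f (fun p => p.1 * p.2) (fun=> t) p) => //.
    exact: cf.
  exact: cst_continuous.
have cg (p : R * R) : {for p, continuous (fun p : R * R => g p.1 p.2)}.
  apply: cvgD; first by apply: cyx; exact: smooth_continuous.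
  apply: cvgM; first exact: cvg_fst.
  apply: cvgM; first exact: cvg_snd.
  by apply: cyx; exact: smooth_continuous_x.
have -> : y (x, t) = \int[mu]_(r in `[0, 1]) g x r.
  have dF r : is_derive r 1 (fun r : R => r * y (x * r, t)) (g x r).
    have dm := is_derive_lin x r.
    have dr := is_derive1_comp (smooth_dx sm (x * r) t0) dm.
    refine (is_derive_pw_eq (is_derive_mulf (is_derive_idf r) dr) _ _) => //.
    by rewrite /g /=; ring.
  have cgx : continuous (g x).
    by move=> r; exact: (continuous_pair (f := g) (@cg (x, r))).2.
  by rewrite (unit_integral_FTC2 dF cgx) mul0r subr0 mul1r mulr1.
apply: (@is_derive_unit_integral _ (fun u r => u * y (u * r, t)) g x 1) => //.
- move=> u r _.
  refine (is_derive_pw_eq (is_derive_mulf (is_derive_idf u) (dcomp u r)) _ _) => //.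
  by rewrite /g; ring.
- move=> u r _; apply: cvgM; first exact: cvg_fst.
  by apply: cyx; exact: smooth_continuous.
Qed.

(** The equation in divergence form makes [x * partial_t y (x * r, t)] the r-derivative of arctan
    y_x at [(x * r, t)]. *)
Lemma EH_mass_dt x t : 0 < t ->
  is_derive t 1 (EH_mass x) (atan (partial_x y (x, t)) - atan (partial_x y (0, t))).
Proof.
move=> t0; pose g s r := x * partial_t y (x * r, s).
have cyx (f : R * R -> R) (p : R * R) : 0 < p.1 ->
    (forall p : R * R, 0 < p.2 -> {for p, continuous f}) ->
    {for p, continuous (fun p : R * R => x * f (x * p.2, p.1))}.
  move=> p0 cf; apply: cvgMr.
  apply: (@continuous_slice _ f (fun p => x * p.2) (fun p => p.1) p) => //.
  - exact: cf.
  - by apply: cvgMr; exact: cvg_snd.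
  - exact: cvg_fst.
have near_t s : `|s - t| <= t / 2 -> 0 < s by rewrite ler_norml; lra.
have -> : atan (partial_x y (x, t)) - atan (partial_x y (0, t)) =
    \int[mu]_(r in `[0, 1]) g t r.
  have dF r : is_derive r 1 (fun r : R => atan (partial_x y (x * r, t))) (g t r).
    have dm := is_derive_lin x r.
    have dc := is_derive_atanf (is_derive1_comp (smooth_dxx sm (x * r) t0) dm).
    refine (is_derive_pw_eq dc _ _) => //=.
    by rewrite /g (EH_equation EH) //= mulrAC mulrC.
  have cgt : continuous (g t).
    move=> r; apply: (continuous_pair (f := g) _).2.
    by apply: (cyx (partial_t y) (t, r)) => //; exact: smooth_continuous_t.
  by rewrite (unit_integral_FTC2 dF cgt) mulr0 mulr1.
apply: (@is_derive_unit_integral _ (fun s r => x * y (x * r, s)) g t (t / 2)).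
- lra.
- by move=> s r /near_t s0; apply: is_derive_cmulf; exact: smooth_dt.
- by move=> s r /near_t s0; apply: (cyx y) => //; exact: smooth_continuous.
- by move=> s r /near_t s0; apply: (cyx (partial_t y)) => //; exact: smooth_continuous_t.
Qed.

Lemma EH_mass_continuous_abs x : {for 0, continuous (fun t => EH_mass x `|t|)}.
Proof.
apply: (@continuous_unit_integral _ (fun t r => x * y (x * r, `|t|)) 0 1) => // t r _.
apply: cvgMr.
apply: (@continuous_slice _ (fun p => y (p.1, `|p.2|)) (fun p => x * p.2) (fun p => p.1)).
- exact: EH_continuous_abs.
- by apply: cvgMr; exact: cvg_snd.
- exact: cvg_fst.
Qed.

End EH_mass.

Section EH_flux.
Context {R : realType} (y0 : R -> R) (y : R * R -> R).
Hypothesis EH : Ecker_Huisken_solution y0 y.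
Notation mu := (@lebesgue_measure R).
Implicit Types (x t s : R).

(* The value at [s <= 0], where [partial_x y] is junk, is fixed to be [0]. *)
Definition EH_angle0 s : R := if 0 < s then atan (partial_x y (0, s)) else 0.

(** Its time derivative cancels the boundary term at 0 in [EH_mass_dt]. *)
Definition EH_flux0 t : R := \int[mu]_(s in `[0, t]) EH_angle0 s.

Lemma EH_angle0_bound s : `|EH_angle0 s| <= 2.
Proof.
have pih := pihalf_lt2 R.
rewrite /EH_angle0; case: ifP => _; last by rewrite normr0.
by rewrite ler_norml; have := atan_ltpi2 (partial_x y (0, s));
  have := atan_gtNpi2 (partial_x y (0, s)); lra.
Qed.

Lemma EH_angle0_continuous t : 0 < t -> {for t, continuous EH_angle0}.
Proof.
move=> t0.
have c1 : {for t, continuous (fun s => atan (partial_x y (0, s)))}.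
  apply: (@continuous_comp _ _ _ (fun s => partial_x y (0, s)) (@atan R)).
    apply: (continuous_pair (f := fun u s => partial_x y (u, s)) _).2.
    have c := @smooth_continuous_x _ _ (EH_smooth EH) (0, t) t0.
    by apply: cvg_trans c; apply: near_eq_cvg; apply: nearW => -[].
  exact: continuous_atan.
have E : {near t, EH_angle0 =1 fun s => atan (partial_x y (0, s))}.
  by near=> s; rewrite /EH_angle0 ifT//; near: s; exact: lt_nbhsr.
have Et : EH_angle0 t = atan (partial_x y (0, t)) by rewrite /EH_angle0 t0.
apply: cvg_trans (near_eq_cvg _) _; last by rewrite Et; exact: c1.
by apply: filterS E => s ->.
Unshelve. all: by end_near. Qed.

(** Measurability comes from continuity on the open interval and integrability from the bound 2,
    whatever happens as time tends to 0. *)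
Lemma EH_angle0_integrable t : 0 < t -> mu.-integrable `[0, t] (EFin \o EH_angle0).
Proof.
move=> t0; apply: measurable_bounded_integrable.
- exact: measurable_itv.
- by rewrite /= lebesgue_measure_itv /= lte_fin t0 -EFinD ltry.
- apply/measurable_fun_itv_obnd_cbndP/measurable_fun_itv_bndo_bndcP.
  apply: open_continuous_measurable_fun; first exact: interval_open.
  by move=> s; rewrite inE /= in_itv /= => /andP[s0 _]; exact: EH_angle0_continuous.
- exists 2; split => // M M2 s _ /=.
  by apply: le_trans (EH_angle0_bound s) (ltW M2).
Qed.

Lemma EH_flux0_dt t : 0 < t ->
  is_derive t 1 EH_flux0 (atan (partial_x y (0, t))).
Proof.
move=> t0; have t1 : t < t + 1 by rewrite ltrDl.
have t10 : 0 < t + 1 by lra.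
have [d dE] := continuous_FTC1_closed t1 (EH_angle0_integrable t10) t0 (EH_angle0_continuous t0).
by apply: DeriveDef; [exact: d|rewrite -derive1E dE /EH_angle0 t0].
Qed.

Lemma EH_flux0_cvg0 : EH_flux0 t @[t --> 0] --> 0.
Proof.
exact: (parameterized_integral_cvg_left ltr01 (EH_angle0_integrable ltr01)).
Qed.

End EH_flux.

(** * Area under the initial graph *)

Section initial_mass.
Context {R : realType} (y0 : R -> R) (A0 : R).
Hypothesis y0_ge0 : forall x, 0 <= y0 x.
Hypothesis y0_cont : continuous y0.
Hypothesis A0E : 'N[@lebesgue_measure R]_1[EFin \o y0]%E = A0%:E.
Notation mu := (@lebesgue_measure R).
Implicit Types (x t s : R).

Definition initial_mass x : R := \int[mu]_(s in `]-oo, x]) y0 s.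

Lemma initial_integral : (\int[mu]_s (y0 s)%:E)%E = A0%:E.
Proof.
rewrite -A0E Lnorm1; apply: eq_integral => s _ /=.
by rewrite ger0_norm.
Qed.

Lemma initial_integrable : mu.-integrable setT (EFin \o y0).
Proof.
apply/integrableP; split.
  by apply/measurable_EFinP; exact: continuous_measurable_fun.
rewrite [ltLHS](_ : _ = A0%:E) ?ltry// -initial_integral.
by apply: eq_integral => s _ /=; rewrite ger0_norm.
Qed.

Lemma initial_mass_bounds x : 0 <= initial_mass x <= A0.
Proof.
apply/andP; split; first by apply: Rintegral_ge0 => s _.
have m : measurable_fun setT (EFin \o y0) by have /integrableP[] := initial_integrable.
have leA : (\int[mu]_(s in `]-oo, x]) (y0 s)%:E <= A0%:E)%E.
  rewrite -initial_integral; apply: ge0_subset_integral => //.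
  by move=> s _; rewrite lee_fin.
rewrite -lee_fin; apply: (le_trans _ leA); rewrite /initial_mass /Rintegral fineK//.
rewrite ge0_fin_numE; last by apply: integral_ge0 => s _; rewrite lee_fin.
exact: le_lt_trans leA (ltry A0).
Qed.

Lemma initial_mass_dx x : is_derive x 1 initial_mass (y0 x).
Proof.
have x1 : x < x + 1 by rewrite ltrDl.
have yi : mu.-integrable `]-oo, (x + 1)] (EFin \o y0).
  by apply: integrableS initial_integrable.
have [|d dE] := continuous_FTC1 x1 yi _ (@y0_cont x).
  exact: ltNyr.
by apply: DeriveDef; [exact: d|rewrite -derive1E dE].
Qed.

End initial_mass.

(** * The potential of the Ecker-Huisken solution *)

Section EH_potential.
Context {R : realType} (y0 : R -> R) (y : R * R -> R) (A0 : R).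
Hypothesis EH : Ecker_Huisken_solution y0 y.
Hypothesis y0_ge0 : forall x, 0 <= y0 x.
Hypothesis A0E : 'N[@lebesgue_measure R]_1[EFin \o y0]%E = A0%:E.
Implicit Types (x t : R).

Let y0_cont := EH_initial_continuous EH.

(* The area to the left of [0] is defined through the flux at [0], because the
   integrability of [y (., t)] is not known for [t > 0]. *)
Definition EH_pot x t : R := initial_mass y0 0 + EH_flux0 y t + EH_mass y x t.

Lemma EH_pot_dx x t : 0 < t -> is_derive x 1 (EH_pot ^~ t) (y (x, t)).
Proof.
move=> t0; refine (is_derive_pw_eq (is_derive_addf
  (is_derive_cst (initial_mass y0 0 + EH_flux0 y t) x (1 : R)) (EH_mass_dx EH x t0)) _ _) => //.
by rewrite add0r.
Qed.

Lemma EH_pot_dt x t : 0 < t -> is_derive t 1 (EH_pot x) (atan (partial_x y (x, t))).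
Proof.
move=> t0; refine (is_derive_pw_eq (is_derive_addf (is_derive_addf
  (is_derive_cst (initial_mass y0 0) t (1 : R)) (EH_flux0_dt EH t0)) (EH_mass_dt EH x t0)) _ _) => //.
by ring.
Qed.

Lemma EH_mass_0 x : EH_mass y x 0 = initial_mass y0 x - initial_mass y0 0.
Proof.
have dF (r : R) : is_derive r 1 (fun r : R => initial_mass y0 (x * r)) (x * y0 (x * r)).
  have dm := is_derive_lin x r.
  refine (is_derive_pw_eq (is_derive1_comp (initial_mass_dx y0_ge0 y0_cont A0E (x * r)) dm) _ _) => //.
  by rewrite mulrC.
have cf : continuous (fun r : R => x * y0 (x * r)).
  move=> r; apply: cvgMr.
  apply: (@continuous_comp _ _ _ ( *%R x) y0); last exact: y0_cont.
  by apply: cvgMr; exact: cvg_id.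
have := unit_integral_FTC2 dF cf; rewrite mulr1 mulr0 => <-.
by apply: eq_Rintegral => r _; rewrite (EH_initial EH).
Qed.

(** The time derivative is an arctangent, hence bounded by 2, but it is available only for positive
    times. The estimate is therefore made from a small [s > 0], where continuity at 0 brings
    [EH_pot x s] close to the initial mass. *)
Lemma EH_pot_initial x t : 0 < t -> `|EH_pot x t - initial_mass y0 x| <= 2 * t.
Proof.
move=> t0; pose D s := initial_mass y0 0 + EH_flux0 y s + EH_mass y x `|s|.
have cD : D s @[s --> 0] --> initial_mass y0 x.
  have -> : initial_mass y0 x = initial_mass y0 0 + 0 + EH_mass y x `|0 : R|.
    by rewrite normr0 EH_mass_0 addr0 subrKC.
  apply: cvgD; last exact: (@EH_mass_continuous_abs _ _ _ EH x).
  by apply: cvgD; [exact: cvg_cst|exact: (@EH_flux0_cvg0 _ _ _ EH)].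
apply/ler_addgt0Pr => e e0.
have /cvgrPdist_lt /(_ _ e0) [d /= d0 Hd] := cD.
pose s := Num.min (d / 2) (t / 2).
have s0 : 0 < s by rewrite lt_min; apply/andP; split; lra.
have sd : s <= d / 2 by rewrite ge_min lexx.
have st : s <= t / 2 by rewrite ge_min lexx orbT.
have := Hd s; rewrite /= sub0r normrN gtr0_norm // => /(_ ltac:(lra)).
have -> : D s = EH_pot x s by rewrite /D gtr0_norm.
move=> h.
have st0 : `|s - t| = t - s by rewrite ler0_norm ?opprB //; lra.
have : `|EH_pot x s - EH_pot x t| <= 2 * `|s - t|.
  apply: (@mean_value_bound _ (EH_pot x) (fun u => atan (partial_x y (x, u)))) => u.
  rewrite st0 => hu; split.
    by apply: EH_pot_dt; move: hu; rewrite ler_norml; lra.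
  have pih := pihalf_lt2 R.
  by rewrite ler_norml; have := atan_ltpi2 (partial_x y (x, u));
    have := atan_gtNpi2 (partial_x y (x, u)); lra.
rewrite st0; move: h; rewrite !ltr_norml !ler_norml; lra.
Qed.

Lemma EH_csf_potential : csf_potential EH_pot (fun x t => y (x, t))
  (fun x t => partial_x y (x, t)) (fun x t => partial_x (partial_x y) (x, t)).
Proof.
have sm := EH_smooth EH.
have cy (p : R * R) : 0 < p.2 -> {for p, continuous (fun p : R * R => y (p.1, p.2))}.
  move=> p0; have c := smooth_continuous sm p0.
  by case: p p0 c => x t t0 c; apply: cvg_trans c; apply: near_eq_cvg; apply: nearW => -[].
have dt x t : 0 < t -> is_derive t 1 (EH_pot x) (atan (partial_x y (x, t))) by exact: EH_pot_dt.
split.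
- move=> p p0; apply: (continuous_of_partials EH_pot_dx dt _ p0 (cy p p0)) => x t _.
  have pih := pihalf_lt2 R.
  by rewrite ler_norml; have := atan_ltpi2 (partial_x y (x, t));
    have := atan_gtNpi2 (partial_x y (x, t)); instantiate (1 := 2); lra.
- exact: cy.
- exact: EH_pot_dx.
- by move=> x t t0; exact: smooth_dx.
- by move=> x t t0; exact: smooth_dxx.
- exact: dt.
- move=> x t t0; have h := EH_equation EH (p := (x, t)) t0.
  by rewrite -h; exact: smooth_dt.
- move=> x t t0; have := EH_pot_initial x t0.
  have /andP[] := initial_mass_bounds y0_ge0 y0_cont A0E x.
  by rewrite ler_norml; lra.
Qed.

(** Under reflection this becomes the lower bound [pot_ge_initial]. *)
Lemma EH_pot_le x t : 0 < t -> EH_pot x t <= A0 + 2 * t.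
Proof.
move=> t0; have := EH_pot_initial x t0.
have /andP[] := initial_mass_bounds y0_ge0 y0_cont A0E x.
by rewrite ler_norml; lra.
Qed.

End EH_potential.

(** * Reflection in space and the final estimate *)

Lemma is_derive_reflect (R : realType) (f : R -> R) (x df : R) :
  is_derive (- x) 1 f df -> is_derive x 1 (fun u : R => f (- u)) (- df).
Proof.
move=> dfx; have dN : is_derive x 1 (fun u : R => - u) (- 1).
  by refine (is_derive_pw_eq (is_derive_lin (-1) x) _ _) => // u; rewrite mulN1r.
refine (is_derive_pw_eq (@is_derive1_comp _ f (fun u => - u) x _ _ dfx dN) _ _) => //.
by rewrite mulrN1.
Qed.

(** The flow is invariant under x -> -x. The slope changes sign, and since arctan is odd this
    matches the sign change of the potential. *)
Lemma csf_potential_reflect (R : realType) (A y w z : R -> R -> R) (A0 : R) :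
  csf_potential A y w z -> (forall x t, 0 < t -> A x t <= A0 + 2 * t) ->
  csf_potential (fun x t => A0 - A (- x) t) (fun x t => y (- x) t)
    (fun x t => - w (- x) t) (fun x t => z (- x) t).
Proof.
move=> [cA cy dA dy dw At yt _] Ale.
have cN (f : R -> R -> R) (p : R * R) :
    (forall p : R * R, 0 < p.2 -> {for p, continuous (fun p => f p.1 p.2)}) ->
    0 < p.2 -> {for p, continuous (fun p => f (- p.1) p.2)}.
  move=> cf p0; apply: (@continuous2_cvg _ R R R _ _ (fun p => - p.1) snd f (- p.1) p.2).
  - exact: (cf (- p.1, p.2)).
  - by apply: cvgN; exact: cvg_fst.
  - exact: cvg_snd.
split.
- by move=> p p0; apply: cvgB; [exact: cvg_cst|exact: cN].
- by move=> p p0; exact: cN.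
- move=> x t t0; refine (is_derive_pw_eq (is_derive_addf
    (is_derive_cst A0 x (1 : R)) (is_derive_cmulf (-1) (is_derive_reflect (dA (- x) t t0)))) _ _).
    by move=> u /=; rewrite mulN1r.
  by rewrite mulN1r opprK add0r.
- by move=> x t t0; exact: is_derive_reflect (dy (- x) t t0).
- move=> x t t0; refine (is_derive_pw_eq
    (is_derive_cmulf (-1) (is_derive_reflect (dw (- x) t t0))) _ _).
    by move=> u /=; rewrite mulN1r.
  by rewrite mulN1r opprK.
- move=> x t t0; refine (is_derive_pw_eq (is_derive_addf
    (is_derive_cst A0 t (1 : R)) (is_derive_cmulf (-1) (At (- x) t t0))) _ _).
    by move=> u /=; rewrite mulN1r.
  by rewrite mulN1r add0r atanN.
- by move=> x t t0; rewrite sqrrN; exact: yt.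
- by move=> x t t0; have := Ale (- x) t t0; lra.
Qed.

(** Since 7040 = 64 * 110, exp(q/64) >= 1 + q/64 >= 111, so the second term is at most 1/100 of
    exp(-q/4), exactly what the coefficient 99/100 leaves. *)
Lemma gauss_tail_le (R : realType) (q : R) : 7040 <= q ->
  gauss_tail q <= expR (- (q / 4)).
Proof.
move=> q1; rewrite /gauss_tail.
have -> : - (1 / 4 * q) = - (q / 4) by field.
have -> : expR (- (17 / 64 * q)) = expR (- (q / 4)) * expR (- (q / 64)).
  by rewrite -expRD; congr expR; field.
have E0 := expR_gt0 (- (q / 4)).
have : expR (- (q / 64)) <= 1 / 111.
  rewrite expRN div1r lef_pV2 ?posrE ?expR_gt0//.
  by apply: le_trans (expR_ge1Dx _); lra.
by rewrite -(ler_pM2l E0); lra.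
Qed.

Theorem corollary1p6 (R : realType) :
  exists eps0 : R, 0 < eps0 /\
  forall (y0 : R -> R) (A0 : R) (y : R * R -> R),
    (forall x, 0 <= y0 x) ->
    locally_lipschitz y0 ->
    0 < A0 ->
    'N[@lebesgue_measure R]_1[EFin \o y0]%E = A0%:E ->
    Ecker_Huisken_solution y0 y ->
    forall t : R, A0 / pi < t ->
      pi / 2 - A0 / (2 * t) < eps0 ->
      forall x : R,
        y (x, t) <=
        2 * Num.sqrt t * Num.sqrt (- ln (pi / 2 - A0 / (2 * t))).
Proof.
(* With this choice the case [q < 7040] is immediate, since then [d < eps0 <= expR (- (q / 4))]. *)
exists (expR (- (7040 / 4))); split; first exact: expR_gt0.
move=> y0 A0 y y0_ge0 _ A0_gt0 A0E EH t At dlt x.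
have pi0 := pi_gt0 R.
have t0 : 0 < t by apply: lt_trans At; rewrite divr_gt0.
set d := pi / 2 - A0 / (2 * t) in dlt *.
have dE : 2 * t * d = pi * t - A0 by rewrite /d; field; lra.
have d0 : 0 < d.
  have : 0 < 2 * t * d by rewrite dE subr_gt0 mulrC -ltr_pdivrMr.
  by rewrite pmulr_rgt0//; lra.
have pA := EH_csf_potential EH y0_ge0 A0E.
have pB := csf_potential_reflect pA (EH_pot_le EH y0_ge0 A0E).
have := pot_ge_barrier pA x t0.
have := pot_ge_barrier pB (- x) t0; rewrite opprK.
set q := y (x, t) ^+ 2 / t => hB hA.
(* In the sum of [hA] and [hB] the potential at [(x, t)] cancels and only [A0] remains. *)
have dG : d <= gauss_tail q.
  have t20 : 0 < 2 * t by lra.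
  by rewrite -(ler_pM2l t20) dE; clear -hA hB; lra.
have dq : d <= expR (- (q / 4)).
  have [q7|q7] := leP 7040 q; first exact: le_trans dG (gauss_tail_le q7).
  apply: ltW; apply: lt_le_trans dlt _; rewrite ler_expR; clear -q7; lra.
have {}dq : q / 4 <= - ln d.
  rewrite lerNr -[leRHS]expRK ler_ln ?posrE ?expR_gt0//.
have L0 : 0 <= - ln d.
  by apply: le_trans dq; rewrite divr_ge0// divr_ge0 ?sqr_ge0// ltW.
(* Bounding [y] by its absolute value turns the claim into a comparison of squares under a root,
   namely y^2 <= 4 t (- ln d). *)
apply: le_trans (ler_norm _) _.
rewrite -sqrtr_sqr -[2 in leRHS]ger0_norm// -sqrtr_sqr -!sqrtrM ?sqr_ge0//; last first.
  by rewrite mulr_ge0 ?sqr_ge0// ltW.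
apply: ler_wsqrtr.
by move: dq; rewrite ler_pdivrMr// /q ler_pdivrMr// => h; apply: le_trans h _; rewrite expr2; lra.
Qed.
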